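(* For all compositions $\alpha,\beta$, $$G_{P_\alpha}(\bm x;q)G_{P_\beta}(\bm x;q)=\frac1qG_{P_{\alpha\cdot\beta}}(\bm x;q)+\frac{q-1}{q}G_{P_{\alpha\odot\beta}}(\bm x;q).$$ Consequently, for every composition $\alpha=\alpha_1\cdots\alpha_\ell$, $$h_{\lambda(\alpha)}(\bm x)=G_{P_{\alpha_1}}(\bm x;q)\cdots G_{P_{\alpha_\ell}}(\bm x;q)=\sum_{\beta}\frac{(q-1)^{\ell(\alpha)-\ell(\beta)}}{q^{\ell(\alpha)-1}}G_{P_\beta}(\bm x;q),$$ $$G_{P_\alpha}(\bm x;q)=\sum_{\beta}q^{\ell(\beta)-1}(q-1)^{\ell(\alpha)-\ell(\beta)}h_{\lambda(\beta)}(\bm x)=\sum_{\lambda\in\mathcal M(\alpha)}q^{\ell(\lambda)-1}(q-1)^{\ell(\alpha)-\ell(\lambda)}h_\lambda(\bm x),$$ where the sums over $\beta$ run over all coarsenings $\beta$ of $\alpha$ (including $\alpha$ itself). In particular, for compositions $\alpha,\beta$ we have $G_{P_\alpha}(\bm x;q)=G_{P_\beta}(\bm x;q)$ if and only if $\mathcal M(\alpha)=\mathcal M(\beta)$.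
   Context: A composition $\alpha=\alpha_1\cdots\alpha_n$ is a finite sequence of positive integers; $\ell(\alpha)=n$ is its length, $\lambda(\alpha)$ the partition obtained by sorting its parts decreasingly. Concatenation: $\alpha\cdot\beta=\alpha_1\cdots\alpha_n\beta_1\cdots\beta_m$; near-concatenation: $\alpha\odot\beta=\alpha_1\cdots\alpha_{n-1}(\alpha_n+\beta_1)\beta_2\cdots\beta_m$. A coarsening of $\alpha$ is a composition obtained from $\alpha$ by summing (possibly no) groups of adjacent parts. $\mathcal M(\alpha)$ is the multiset $\{\lambda(\beta):\beta\text{ a coarsening of }\alpha\}$. $h_k$ is the complete homogeneous symmetric function and $h_\lambda=h_{\lambda_1}h_{\lambda_2}\cdots$. Rows and LLT polynomials: a row is $R=a/b=\{(1,j):b+1\le j\le a\}$ ($a\ge b\ge0$), the content of $(1,j)$ being $j-1$. A horizontal-strip is a sequence of rows $(R_1,\dots,R_n)$; its LLT polynomial is $G_{\bm\lambda}(\bm x;q)=\sum_{\bm T}q^{\mathrm{inv}(\bm T)}\bm x^{\bm T}$, summed over tuples $\bm T=(T^{(1)},\dots,T^{(n)})$ of left-to-right weakly increasing fillings $T^{(i)}:R_i\to\{1,2,\dots\}$, where $\bm x^{\bm T}=\prod_k x_k^{\#\{\text{entries }=k\}}$ and $\mathrm{inv}(\bm T)$ counts pairs of entries $T^{(i)}(u),T^{(j)}(v)$ with $i<j$ such that either $c(u)=c(v)$ and $T^{(i)}(u)>T^{(j)}(v)$, or $c(u)=c(v)+1$ and $T^{(i)}(u)<T^{(j)}(v)$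 ($c$ = content). For a composition $\alpha=\alpha_1\cdots\alpha_n$, $P_\alpha$ is the weighted path with vertices $v_1,\dots,v_n$, $v_i$ of weight $\alpha_i$, and edges $(v_i,v_{i+1})$ of weight $1$. Its LLT polynomial is $G_{P_\alpha}(\bm x;q):=G_{\bm\lambda_\alpha}(\bm x;q)$ where $\bm\lambda_\alpha=(R_1,\dots,R_n)$, $R_i=(\sum_{j=1}^{n-i+1}\alpha_j)/(\sum_{j=1}^{n-i}\alpha_j)$ (a horizontal-strip whose associated weighted graph, with vertex weights $|R_i|$ and edge weights $M(R_i,R_j)$ for $i<j$, is isomorphic to $P_\alpha$; $G$ depends only on this weighted graph up to isomorphism).
   Formalization: In both expansions of G_{P_α} in the h's, the factor (q-1)^{ℓ(α)-ℓ(·)} is corrected to (1-q)^{ℓ(α)-ℓ(·)}; the printed sign fails for α=(1,1), where G = q h_1^2 + (1-q) h_2. Compositions are taken to be nonempty. *)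

(* Defs.v *)
(* Mathematical Components, with mathcomp.classical.boolp for the equality and
   choice structures on formal power series. *)
From HB Require Import structures.
From mathcomp Require Import all_boot all_order all_algebra.
From mathcomp Require Import finmap multiset.
From mathcomp Require Import boolp.

Set Implicit Arguments.
Unset Strict Implicit.
Unset Printing Implicit Defensive.

Import GRing.Theory.

Local Open Scope ring_scope.

(* Monomials in x_0, x_1, ... are finite multisets of variable indices. *)
Notation monom := ({mset nat})%mset.

Definition submsets (m : monom) : seq monom :=
  undup [seq seq_mset (mask (b : bitseq) m) | b : (size m).-tuple bool].

Lemma submsets_uniq m : uniq (submsets m).
Proof. exact: undup_uniq. Qed.

Lemma mem_submsets m d : (d \in submsets m) = (d `<=` m)%mset.
Proof.
rewrite mem_undup; apply/imageP/msubsetP => [[b _ ->] x|le_dm].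
  by rewrite mset_seqE -count_mem_mset leq_count_mask.
have le_count x : (count_mem x (d : monom) <= count_mem x m)%N.
  by rewrite !count_mem_mset.
have /count_subseqP[s /subseqP[b sz_b ->] eq_s] := le_count.
exists (Tuple (introT eqP sz_b)) => //=.
by rewrite -[LHS]seq_mset_id; apply/eq_seq_msetP.
Qed.

Lemma submsets_sum (V : nmodType) (F : monom -> V) m d : (d `<=` m)%mset ->
  \sum_(e <- submsets d) F e = \sum_(e <- submsets m | (e `<=` d)%mset) F e.
Proof.
move=> le_dm; rewrite -[RHS]big_filter; apply/perm_big/uniq_perm.
- exact: submsets_uniq.
- by rewrite filter_uniq ?submsets_uniq.
move=> e; rewrite mem_filter !mem_submsets.
by case: (boolP (e `<=` d)%mset) => //= /msubset_trans ->.
Qed.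

Lemma submsets_shift (V : nmodType) (F : monom -> V) m e : (e `<=` m)%mset ->
  \sum_(d <- submsets m | (e `<=` d)%mset) F d =
  \sum_(c <- submsets (m `\` e)%mset) F (e `+` c)%mset.
Proof.
move=> le_em; rewrite -[LHS]big_filter -[RHS](big_map (msetD e) xpredT).
apply/perm_big/uniq_perm.
- by rewrite filter_uniq ?submsets_uniq.
- by rewrite map_inj_uniq ?submsets_uniq //; apply: can_inj (msetDKB e).
move=> d; rewrite mem_filter mem_submsets; apply/andP/mapP => [[ed dm]|[c]].
  by exists (d `\` e)%mset; rewrite ?mem_submsets ?msetSB ?msetBDKC.
rewrite mem_submsets => cm ->; split.
  by apply/msubsetP => x; rewrite msetE2 leq_addr.
by rewrite -(msetBDKC le_em) msetDS.
Qed.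

Section Series.

Variable R : comNzRingType.

Definition series : Type := monom -> R.

HB.instance Definition _ := gen_eqMixin series.
HB.instance Definition _ := gen_choiceMixin series.

Implicit Types f g h : series.

Definition szero : series := fun=> 0.
Definition sopp f : series := fun m => - f m.
Definition sadd f g : series := fun m => f m + g m.
Definition sscale (c : R) f : series := fun m => c * f m.
Definition sone : series := fun m => (m == mset0)%:R.
Definition smul f g : series :=
  fun m => \sum_(d <- submsets m) f d * g (m `\` d)%mset.

Lemma saddA : associative sadd.
Proof. by move=> f g h; apply/funext => m; apply: addrA. Qed.
Lemma saddC : commutative sadd.
Proof. by move=> f g; apply/funext => m; apply: addrC. Qed.
Lemma sadd0 : left_id szero sadd.
Proof. by move=> f; apply/funext => m; apply: add0r. Qed.
Lemma saddN : left_inverse szero sopp sadd.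
Proof. by move=> f; apply/funext => m; apply: addNr. Qed.

HB.instance Definition _ := GRing.isZmodule.Build series saddA saddC sadd0 saddN.

Lemma smulC : commutative smul.
Proof.
move=> f g; apply/funext => m; rewrite /smul.
have eq_compl : perm_eq (submsets m) [seq (m `\` d)%mset | d <- submsets m].
  apply: uniq_perm; first exact: submsets_uniq.
    rewrite map_inj_in_uniq ?submsets_uniq // => d e.
    by rewrite !mem_submsets => /msetBBK {2}<- /msetBBK {2}<- ->.
  move=> d; rewrite mem_submsets; apply/idP/mapP => [le_dm|[e _ ->]].
    by exists (m `\` d)%mset; rewrite ?mem_submsets ?msubsetDl ?msetBBK.
  exact: msubsetDl.
rewrite (perm_big _ eq_compl) big_map !big_seq; apply: eq_bigr => d.
by rewrite mem_submsets => /msetBBK ->; rewrite mulrC.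
Qed.

Lemma smulA : associative smul.
Proof.
move=> f g h; apply/funext => m; rewrite /smul.
transitivity (\sum_(d <- submsets m) \sum_(e <- submsets m | (e `<=` d)%mset)
                 f e * g (d `\` e)%mset * h (m `\` d)%mset); last first.
  rewrite big_seq [RHS]big_seq; apply: eq_bigr => d.
  by rewrite mem_submsets => le_dm; rewrite (submsets_sum _ le_dm) mulr_suml.
rewrite (exchange_big_dep xpredT) //= big_seq [RHS]big_seq.
apply: eq_bigr => e; rewrite mem_submsets => le_em.
rewrite (submsets_shift _ le_em) mulr_sumr.
by apply: eq_bigr => c _; rewrite mulrA msetDKB msetBDA.
Qed.

Lemma smul1 : left_id sone smul.
Proof.
move=> f; apply/funext => m; rewrite /smul (bigD1_seq mset0) /=.
- rewrite /sone eqxx mul1r msetB0 big1 ?addr0 // => d /negPf->.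
  by rewrite mul0r.
- by rewrite mem_submsets msub0set.
- exact: submsets_uniq.
Qed.

Lemma smulDl : left_distributive smul sadd.
Proof.
move=> f g h; apply/funext => m; rewrite /smul /sadd -big_split.
by apply: eq_bigr => d _; rewrite mulrDl.
Qed.

Lemma sone_neq0 : sone != szero.
Proof.
apply/eqP => /(congr1 (@^~ mset0)) /eqP.
by rewrite /sone /szero eqxx oner_eq0.
Qed.

HB.instance Definition _ :=
  GRing.Zmodule_isComNzRing.Build series smulA smulC smul1 smulDl sone_neq0.

Lemma sscaleA c d f : sscale c (sscale d f) = sscale (c * d) f.
Proof. by apply/funext => m; apply: mulrA. Qed.
Lemma sscale1 : left_id 1 sscale.
Proof. by move=> f; apply/funext => m; apply: mul1r. Qed.
Lemma sscaleDr : right_distributive sscale +%R.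
Proof. by move=> c f g; apply/funext => m; apply: mulrDr. Qed.
Lemma sscaleDl f : {morph sscale^~ f : c d / c + d}.
Proof. by move=> c d; apply/funext => m; apply: mulrDl. Qed.

HB.instance Definition _ :=
  GRing.Zmodule_isLmodule.Build R series sscaleA sscale1 sscaleDr sscaleDl.

Lemma sscaleAl c f g : c *: (f * g) = (c *: f) * g.
Proof.
apply/funext => m; rewrite [LHS]mulr_sumr.
by apply: eq_bigr => d _; rewrite mulrA.
Qed.

HB.instance Definition _ := GRing.Lmodule_isLalgebra.Build R series sscaleAl.
HB.instance Definition _ := GRing.Lalgebra_isComAlgebra.Build R series.

Definition hsym (k : nat) : series := fun m => (size m == k)%:R.

Definition hsyms (l : seq nat) : series := \prod_(k <- l) hsym k.

End Series.

Definition Qq : fieldType := {fraction {poly rat}}.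
Definition q : Qq := tofrac 'X.

(* The pair (a, b) stands for the row a/b, with cells (1, j) for b < j <= a. *)
Definition row : Type := nat * nat.

Section LLT.

Variable s : seq row.

(* The pair (i, j) stands for the cell (1, j) of the i-th row of s. *)
Definition strip_cells : seq (nat * nat) :=
  [seq (i, j) | i <- iota 0 (size s),
                j <- let: (a, b) := nth (0, 0)%N s i in iota b.+1 (a - b)].

Definition cell := seq_sub strip_cells.
Definition rowidx (u : cell) : nat := (val u).1.
Definition column (u : cell) : nat := (val u).2.
Definition content (u : cell) : nat := (column u).-1.

Implicit Type T : cell -> nat.

Definition semistandard T : bool :=
  [forall u, forall v,
    (rowidx u == rowidx v) && (column u <= column v) ==> (T u <= T v)]%N.

Definition inv T : nat :=
  #|[set p : cell * cell | let: (u, v) := p in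
      (rowidx u < rowidx v)
      && ((content u == content v) && (T v < T u)
          || (content u == (content v).+1) && (T u < T v))]|%N.

Definition weight T : monom := seq_mset [seq T u | u : cell].

(* A filling of weight m has all its entries in the support of m, so that each
   coefficient is a finite sum. *)
Definition LLT : series Qq := fun m =>
  \sum_(T : {ffun cell -> finsupp m} |
          semistandard (fun u => val (T u)) && (weight (fun u => val (T u)) == m))
     q ^+ inv (fun u => val (T u)).

End LLT.

(* Compositions are nonempty: near-concatenation and the exponents
   ell(alpha) - 1 need at least one part. *)
Definition composition (a : seq nat) : bool :=
  (a != [::]) && all (fun x => 0 < x)%N a.

Definition near_cat (a b : seq nat) : seq nat :=
  match a, b with
  | x :: a', y :: b' => belast x a' ++ (last x a' + y)%N :: b'
  | _, _ => a ++ b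
  end.

Fixpoint coarsenings (a : seq nat) : seq (seq nat) :=
  match a with
  | [::] => [:: [::]]
  | [:: x] => [:: [:: x]]
  | x :: a' => let bs := coarsenings a' in
               [seq x :: b | b <- bs] ++ [seq near_cat [:: x] b | b <- bs]
  end.

Definition coarsening (b a : seq nat) : Prop :=
  exists s : seq (seq nat),
    [/\ all (fun g => g != [::]) s, flatten s = a & b = [seq sumn g | g <- s]].

Lemma coarsenings_cons x y a : coarsenings [:: x, y & a] =
  [seq x :: b | b <- coarsenings (y :: a)] ++
  [seq near_cat [:: x] b | b <- coarsenings (y :: a)].
Proof. by []. Qed.

Lemma coarseningsP a b : reflect (coarsening b a) (b \in coarsenings a).
Proof.
apply: (iffP idP).
  elim: a b => [|x [|y a] IHa] b; first by rewrite inE => /eqP->; exists [::].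
    by rewrite inE => /eqP->; exists [:: [:: x]]; split; rewrite //= addn0.
  rewrite coarsenings_cons mem_cat.
  case/orP=> /mapP[c /IHa[s [s0 fs ->]] ->{b}].
    by exists ([:: x] :: s); split; rewrite //= ?fs ?addn0.
  case: s s0 fs => [|g s] //= /andP[_ s0] fs.
  by exists ((x :: g) :: s); split; rewrite //= fs.
case=> s [s0 fs ->{b}]; elim: a s s0 fs => [|x a IHa] [|[|z g] s] //= s0 [-> fs].
case: a IHa fs => [|y a] IHa fs.
  case: g fs => //= fs; case: s s0 fs => [|[] //] _ _.
  by rewrite addn0 mem_head.
rewrite mem_cat; case: g fs => [|z' g] fs; apply/orP; [left|right].
  by rewrite addn0 map_f // IHa.
by apply/mapP; exists [seq sumn g' | g' <- (z' :: g) :: s]; rewrite ?IHa.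
Qed.

Lemma coarsenings_uniq a : composition a -> uniq (coarsenings a).
Proof.
rewrite /composition => /andP[_].
elim: a => [|x [|y a] IHa] // /andP[x0 a0]; move: (IHa a0) => U.
rewrite coarsenings_cons cat_uniq map_inj_uniq ?U; last by move=> b c [].
have hd b : b \in coarsenings (y :: a) -> exists z c, b = z.+1 :: c.
  case/coarseningsP => -[|[|z g] s] [] //= _ [Ez _] ->.
  move: a0 => /=; rewrite -Ez; case: z {Ez} => //= z _.
  by exists (z + sumn g)%N, [seq sumn g' | g' <- s].
rewrite andTb; apply/andP; split.
  apply/hasPn => _ /mapP[b /hd[z [c ->]] ->]; apply/mapP => -[d _ [/eqP]].
  by rewrite -[X in _ == X]addn0 eqn_add2l.
rewrite map_inj_in_uniq ?U // => b c /hd[z [b' ->]] /hd[w [c' ->]] [].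
by move=> /eqP; rewrite eqn_add2l => /eqP[->] ->.
Qed.

Definition lam (a : seq nat) : seq nat := sort geq a.

Definition Mset (a : seq nat) : {mset (seq nat)}%mset :=
  seq_mset [seq lam b | b <- coarsenings a].

(* The index i starts from 0 here, so the row R_{i+1} of the strip is
   (alpha_1 + ... + alpha_{n-i}) / (alpha_1 + ... + alpha_{n-i-1}). *)
Definition path_strip (a : seq nat) : seq row :=
  let n := size a in
  mkseq (fun i => (sumn (take (n - i) a), sumn (take (n - i.+1) a))) n.

Definition LLTpath (a : seq nat) : series Qq := LLT (path_strip a).

(* Main.v *)
(* The cells of the strip of P_a have pairwise distinct contents, so a filling is
   a word w of length |a|, weakly increasing inside the blocks cut out by a, and
   inv counts the descents of w at the block boundaries.  A boundary thus weighs
   q + (1 - q) [w_c <= w_(c+1)]: the first term cuts the word in two independent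
   words and the second one merges the two blocks, whence
   G_(a.b) = q G_a G_b + (1 - q) G_(a(.)b).  The expansions follow by induction.
   For the last equivalence, the h_l are linearly independent: applying the
   derivation x_i d/dx_i, which maps h_n to the sum of the x_i^j h_(n-j) over
   1 <= j <= n, to a relation between the h_l, and letting i vary, shows that all
   partial derivatives of the relation with respect to the h_n are relations as
   well, of smaller degree.  Comparing the coefficients of h_(|a|) gives
   ell(a) = ell(b), and then the multiplicities of every l agree. *)
From HB Require Import structures.
Require Import Defs.
From mathcomp Require Import all_boot all_order all_algebra.
From mathcomp Require Import finmap multiset.

Set Implicit Arguments.
Unset Strict Implicit.
Unset Printing Implicit Defensive.

Import GRing.Theory.

Local Open Scope ring_scope.

(** * Generating series of words *)

Lemma perm_msetD (K : choiceType) (A B : {mset K}%mset) :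
  perm_eq (A ++ B) (A `+` B)%mset.
Proof. by apply/allP => x _ /=; rewrite count_cat !count_mem_mset msetE2. Qed.

Section WordSeries.

Variable R : comNzRingType.
Implicit Types (s t : seq (R * R)) (w : seq nat) (u v : R).

(* A step (u, v) gives the weight u + v [x <= y] to consecutive letters x, y:
   (0, 1) imposes x <= y, (1, 0) imposes nothing, and (q, 1 - q) gives weight q
   to descents and 1 to the other pairs. *)
Fixpoint word_weight s w : R :=
  match s, w with
  | [::], [:: _] => 1
  | p :: s', x :: (y :: _) as w' =>
      (p.1 + p.2 * (x <= y)%N%:R) * word_weight s' w'
  | _, _ => 0
  end.

Definition word_series s : series R :=
  fun m => \sum_(w <- permutations m) word_weight s w.

Lemma word_weight_size s w : size w != (size s).+1 -> word_weight s w = 0.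
Proof.
elim: s w => [|p s IHs] [|x [|y w]] //= sz_w.
by rewrite IHs ?mulr0.
Qed.

(** A step enters the weight through a single factor, and that factor is linear in the pair. *)
Lemma word_weight_linear s t u v w :
  word_weight (s ++ (u, v) :: t) w =
  u * word_weight (s ++ (1, 0) :: t) w + v * word_weight (s ++ (0, 1) :: t) w.
Proof.
elim: s w => [|p s IHs] [|x [|y w]] /=; rewrite ?mulr0 ?addr0 //.
  by rewrite mul0r addr0 add0r mul1r !mul1r mulrDl !mulrA.
by rewrite IHs mulrDr !(mulrCA _ (p.1 + _)).
Qed.

Lemma word_series_linear s t u v :
  word_series (s ++ (u, v) :: t) =
  u *: word_series (s ++ (1, 0) :: t) + v *: word_series (s ++ (0, 1) :: t).
Proof.
apply/boolp.funext => m; rewrite /word_series.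
under eq_bigr do rewrite word_weight_linear.
by rewrite big_split -!mulr_sumr.
Qed.

Lemma word_weight_cat s t w1 w2 : size w1 = (size s).+1 ->
  word_weight (s ++ (1, 0) :: t) (w1 ++ w2) =
    word_weight s w1 * word_weight t w2.
Proof.
elim: s w1 => [|p s IHs] [|x w1] //=.
  (* If [w2] is empty, both sides vanish: even [[::]] weighs only words with one letter. *)
  case: w1 => //= _; case: w2 => [|y w2]; last by rewrite mul0r addr0.
  by case: t => [|? ?]; rewrite /= mulr0.
case: w1 => [|y w1] //= [sz_w1]; rewrite -mulrA -(IHs (y :: w1)) //=.
by rewrite sz_w1.
Qed.

(** Cutting a word after [k] letters is a bijection, and [d] is forced to be the multiset of the
    letters of the prefix. *)
Lemma sum_permutations_cat (V : nmodType) (m : monom) (k : nat)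
    (F : seq nat -> V) :
  \sum_(d <- submsets m) \sum_(w1 <- permutations d | size w1 == k)
    \sum_(w2 <- permutations (m `\` d)%mset) F (w1 ++ w2) =
  \sum_(w <- permutations m | (k <= size w)%N) F w.
Proof.
(* The inner sum has exactly one term; it is inserted so that the sums over [w] and [d] can be
   exchanged. *)
transitivity (\sum_(w <- permutations m | (k <= size w)%N)
   \sum_(d <- submsets m | d == seq_mset (take k w)) F w); last first.
  rewrite big_seq_cond [RHS]big_seq_cond; apply: eq_bigr => w /andP[wm _].
  rewrite -big_filter filter_pred1_uniq ?big_seq1 ?submsets_uniq //.
  rewrite mem_submsets; apply/msubsetP => x; rewrite mset_seqE -count_mem_mset.
  move: wm; rewrite mem_permutations => /permP <-.
  by rewrite -{2}(cat_take_drop k w) count_cat leq_addr.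
rewrite (exchange_big_dep xpredT) //= big_seq [RHS]big_seq.
apply: eq_bigr => d; rewrite mem_submsets => le_dm.
rewrite -big_filter -[RHS]big_filter.
rewrite -(@big_allpairs_dep _ _ _ _ _ _ cat _
  (fun=> permutations (m `\` d)%mset) F).
apply/perm_big/uniq_perm.
- apply: allpairs_uniq; rewrite ?filter_uniq ?permutations_uniq //.
  move=> [w1 w2] [w1' w2'] /allpairsP[[a a']/= [+ _ [-> ->]]].
  rewrite mem_filter => /andP[/eqP sz_a _] /allpairsP[[b b']/= [+ _ [-> ->]]].
  rewrite mem_filter => /andP[/eqP sz_b _] /eqP.
  by rewrite eqseq_cat ?sz_a // => /andP[/eqP-> /eqP->].
- by rewrite filter_uniq ?permutations_uniq.
move=> w; rewrite mem_filter mem_permutations; apply/allpairsP/idP.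
  case=> -[w1 w2] /= []; rewrite mem_filter !mem_permutations.
  move=> /andP[/eqP sz1 p1] p2 ->; rewrite size_cat sz1 leq_addr take_cat sz1.
  rewrite ltnn subnn take0 cats0 /=; apply/andP; split.
    rewrite eq_sym -[X in _ == X]seq_mset_id; apply/eqP/eq_seq_msetP.
    by rewrite p1.
  have := perm_msetD d (m `\` d)%mset; rewrite msetBDKC //.
  exact: perm_trans (perm_cat p1 p2).
case/andP=> /andP[szw /eqP d_def] pm.
exists (take k w, drop k w); rewrite mem_filter !mem_permutations /=.
rewrite size_takel ?eqxx //= cat_take_drop; split=> //.
  by rewrite d_def perm_sym perm_eq_seq_mset.
apply/allP => x _ /=; rewrite !count_mem_mset msetE2 d_def mset_seqE.
move/permP: pm => /(_ (pred1 x)); rewrite count_mem_mset => <-.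
by rewrite -{2}(cat_take_drop k w) count_cat addKn.
Qed.

(** The step [(1, 0)] puts no condition on the junction, so the convolution over submultisets
    becomes a sum over concatenated words. Words of the wrong length have weight 0 and drop out on
    both sides. *)
Lemma word_series_mul s t :
  word_series s * word_series t = word_series (s ++ (1, 0) :: t).
Proof.
apply/boolp.funext => m; rewrite /word_series.
rewrite [LHS](_ : _ = \sum_(d <- submsets m)
    \sum_(w1 <- permutations d | size w1 == (size s).+1)
    \sum_(w2 <- permutations (m `\` d)%mset)
       word_weight (s ++ (1, 0) :: t) (w1 ++ w2)).
  rewrite sum_permutations_cat [RHS](bigID (fun w => size s < size w)%N) /=.
  rewrite [X in _ = _ + X]big1 ?addr0 // => w.
  rewrite -leqNgt => szw; apply: word_weight_size.
  by rewrite neq_ltn ltnS size_cat (leq_trans szw) ?leq_addr.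
apply: eq_bigr => d _; rewrite mulr_suml.
rewrite (bigID (fun w1 => size w1 == (size s).+1)) /=.
rewrite [X in _ + X]big1 ?addr0; last first.
  by move=> w1 sz; rewrite word_weight_size ?mul0r.
apply: eq_bigr => w1 /eqP sz; rewrite mulr_sumr.
by apply: eq_bigr => w2 _; rewrite word_weight_cat.
Qed.

Lemma word_weight_inner k w :
  word_weight (nseq k (0, 1)) w = (sorted leq w && (size w == k.+1))%:R.
Proof.
elim: k w => [|k IHk] [|x [|y w]] //=; rewrite ?andbF //.
by rewrite IHk /= add0r mul1r -natrM mulnb andbA.
Qed.

(** A multiset has exactly one weakly increasing arrangement. *)
Lemma word_series_inner k : word_series (nseq k (0, 1)) = hsym R k.+1.
Proof.
apply/boolp.funext => m; rewrite /word_series /hsym.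
have m_sort : sort leq m \in permutations m.
  by rewrite mem_permutations perm_sort.
rewrite (bigD1_seq (sort leq m)) ?permutations_uniq //= big_seq_cond big1.
  by rewrite addr0 word_weight_inner sort_sorted ?size_sort //;
    apply: leq_total.
move=> w; rewrite mem_permutations word_weight_inner => /andP[wm].
case: (boolP (sorted leq w)) => //= w_sort /negP[].
apply/eqP/(sorted_eq leq_trans anti_leq) => //.
  exact/sort_sorted/leq_total.
by rewrite perm_sym perm_sort perm_sym.
Qed.

End WordSeries.

(** * LLT polynomials of paths as word series *)

Lemma word_weight_prod (R : comNzRingType) (s : seq (R * R)) w :
  size w = (size s).+1 ->
  word_weight s w = \prod_(c < size s)
    ((nth (0, 0) s c).1 +
     (nth (0, 0) s c).2 * (nth 0 w c <= nth 0 w c.+1)%N%:R).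
Proof.
elim: s w => [|p s IHs] [|x w] //= [sz_w].
  by rewrite big_ord0; case: w sz_w.
case: w sz_w => [|y w] // sz_w.
by rewrite big_ord_recl -(IHs (y :: w)).
Qed.

Section Fillings.

Variables (s : seq Defs.row) (cs : seq (cell s)).
Hypotheses (cs_uniq : uniq cs) (mem_cs : forall u, u \in cs).

(** Reading a filling along [cs] is a bijection from the fillings of weight [m] to the arrangements
    of [m] that have one letter per cell. *)
Lemma LLT_words (F : seq nat -> Qq) (m : monom) :
    (forall T : cell s -> nat,
       F [seq T u | u <- cs] = (semistandard T)%:R * q ^+ Defs.inv T) ->
  LLT s m = \sum_(w <- permutations m | size w == size cs) F w.
Proof.
move=> F_T; pose word (T : {ffun cell s -> finsupp m}) :=
  [seq val (T u) | u <- cs].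
have cs_enum : perm_eq (enum {: cell s}) cs.
  by apply: uniq_perm; rewrite ?enum_uniq // => u; rewrite mem_enum mem_cs.
have weightE (T : {ffun cell s -> finsupp m}) :
    (weight (fun u => val (T u)) == m) = perm_eq (word T) m.
  have /permPl <- : perm_eq [seq val (T u) | u : cell s] (word T)
    by apply: perm_map.
  apply/eqP/idP => [eq_m|pm].
    by have := perm_eq_seq_mset [seq val (T u) | u : cell s];
      rewrite -/(weight (fun u => val (T u))) eq_m perm_sym.
  by rewrite -[RHS]seq_mset_id; apply/eq_seq_msetP.
transitivity (\sum_(T | perm_eq (word T) m) F (word T)).
  rewrite /LLT big_mkcondl /=; apply: eq_big => T; first exact: weightE.
  by rewrite F_T; case: ifP => _; rewrite ?mul0r ?mul1r.
rewrite -big_filter -(big_map word xpredT) -[RHS]big_filter.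
apply/perm_big/uniq_perm.
- rewrite map_inj_uniq ?filter_uniq ?index_enum_uniq // =>
  T T' /eq_in_map eqTT'.
  by apply/ffunP => u; apply/val_inj/eqTT'.
- by rewrite filter_uniq ?permutations_uniq.
move=> w; rewrite mem_filter mem_permutations; apply/mapP/andP.
  case=> T; rewrite mem_filter => /andP[pT _] ->.
  by rewrite size_map eqxx.
case=> /eqP szw wm.
have wP u : nth 0%N w (index u cs) \in finsupp m.
  by rewrite msuppE -(perm_mem wm) mem_nth // szw index_mem.
have w_def : word [ffun u => FSetSub (wP u)] = w.
  apply: (@eq_from_nth _ 0%N); rewrite size_map // => c lt_c.
  have [u0 _] : exists u, u \in cs by case: (cs) lt_c => // u l; exists u;
    rewrite mem_head.
  by rewrite (nth_map u0) // ffunE /= index_uniq.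
exists [ffun u => FSetSub (wP u)]; rewrite // mem_filter mem_index_enum andbT.
by rewrite w_def.
Qed.

Hypothesis columns : [seq column u | u <- cs] = iota 1 (size cs).
Hypothesis rows : sorted geq [seq rowidx u | u <- cs].

(** Along [cs] the contents are 0, 1, 2, ..., so distinct cells never share a content, and every
    inversion is a descent between consecutive cells of different rows. As [rows] makes each row an
    interval of [cs], semistandardness is also a condition on consecutive cells. *)
Lemma fillings_prod (T : cell s -> nat) (x0 : cell s) :
  (semistandard T)%:R * q ^+ Defs.inv T =
  \prod_(c < (size cs).-1)
    (let u := nth x0 cs c in let v := nth x0 cs c.+1 in
     if rowidx u == rowidx v then (T u <= T v)%N%:R
     else if (T u <= T v)%N then 1 else q).
Proof.
have lt_cs c : (c < (size cs).-1)%N -> (c.+1 < size cs)%N by case: (size cs).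
have col c : (c < size cs)%N -> column (nth x0 cs c) = c.+1.
  by move=> lt_c; rewrite -(nth_map _ 0%N) // columns nth_iota.
have row_le c d : (c <= d < size cs)%N ->
    (rowidx (nth x0 cs d) <= rowidx (nth x0 cs c))%N.
  case/andP=> le_cd lt_d; have lt_c := leq_ltn_trans le_cd lt_d.
  rewrite -!(nth_map _ 0%N (@rowidx s)) //.
  have geq_trans : transitive geq by move=> x y z le_xy /leq_trans; apply.
  by apply: (sorted_leq_nth geq_trans leqnn _ rows) => //; rewrite inE size_map.
have cellP u : exists2 c, (c < size cs)%N & u = nth x0 cs c.
  by exists (index u cs); rewrite ?index_mem ?nth_index.
have [ssT|nssT] := boolP (semistandard T); last first.
  (* By contraposition: a nonzero product makes [T] increase at each step inside a row. *)
  rewrite mul0r; apply/esym/eqP; apply: contraNT nssT => /prodf_neq0 prod0.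
  have step c : (c < (size cs).-1)%N ->
      rowidx (nth x0 cs c) = rowidx (nth x0 cs c.+1) ->
      (T (nth x0 cs c) <= T (nth x0 cs c.+1))%N.
    move=> lt_c eq_row; have := prod0 (Ordinal lt_c) isT.
    by rewrite /= eq_row eqxx; case: (_ <= _)%N; rewrite ?eqxx.
  apply/forallP => u; apply/forallP => v; apply/implyP => /andP[/eqP eq_row].
  have [c lt_c def_u] := cellP u; have [d lt_d def_v] := cellP v.
  rewrite {}def_u {}def_v in eq_row *; rewrite !col // ltnS => le_cd.
  elim: d => [|d IHd] in lt_d eq_row le_cd *; first by move: le_cd;
    rewrite leqn0 => /eqP->.
  move: le_cd; rewrite leq_eqVlt => /predU1P[<- //|]; rewrite ltnS => le_cd.
  (* Row indices decrease weakly, so position [d], squeezed between two cells of one row, lies in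
     that row. *)
  have eq_d : rowidx (nth x0 cs c) = rowidx (nth x0 cs d).
    apply/eqP; rewrite eqn_leq {1}eq_row !row_le //.
      by rewrite le_cd (ltn_trans _ lt_d).
    by rewrite leqnSn.
  apply: leq_trans (IHd (ltnW lt_d) eq_d le_cd) (step _ _ _).
    by case: (size cs) lt_d.
  by rewrite -eq_d.
rewrite mul1r; set A := [set c : 'I_(size cs).-1 |
  (rowidx (nth x0 cs c) != rowidx (nth x0 cs c.+1))
  && (T (nth x0 cs c.+1) < T (nth x0 cs c))%N].
have -> : Defs.inv T = #|A|.
  (* The later cell comes first in the pair: it has the smaller row index and the larger content. *)
  rewrite -(card_imset A (f := fun c : 'I__ => (nth x0 cs c.+1, nth x0 cs c))).
    apply: eq_card => -[u v]; rewrite inE; apply/idP/imsetP; last first.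
      case=> c; rewrite inE => /andP[ne_row lt_T] [-> ->].
      have := lt_cs _ (ltn_ord c) => lt_c;
        rewrite /content !col ?(ltnW lt_c) //=.
      rewrite eqxx lt_T orbT andbT ltn_neqAle eq_sym ne_row row_le //.
      by rewrite leqnSn.
    have [c lt_c ->] := cellP u; have [d lt_d ->] := cellP v.
    rewrite /content !col //= => /andP[lt_row /orP[/andP[/eqP eq_cd]|/andP[/eqP
      eq_cd lt_T]]].
      by rewrite eq_cd ltnn in lt_row.
    rewrite eq_cd in lt_c lt_T lt_row *.
    have lt_d' : (d < (size cs).-1)%N by case: (size cs) lt_c.
    exists (Ordinal lt_d'); rewrite // inE /= lt_T andbT.
    by rewrite neq_ltn lt_row orbT.
  move=> c d [_ /eqP]; rewrite nth_uniq //; first by move/eqP/val_inj.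
    exact: ltnW (lt_cs _ (ltn_ord c)).
  exact: ltnW (lt_cs _ (ltn_ord d)).
rewrite -sum1_card big_mkcond /= -prodrXr; apply: eq_bigr => c _.
rewrite inE /=; have lt_c := lt_cs _ (ltn_ord c).
have [eq_row|ne_row] := eqVneq; last by rewrite ltnNge; case: (_ <= _)%N.
rewrite expr0; move/forallP/(_ (nth x0 cs c))/forallP/(_ (nth x0 cs c.+1)): ssT.
by rewrite eq_row eqxx !col ?(ltnW lt_c) // leqnSn /= => ->.
Qed.

End Fillings.

(** * Blocks of a composition and the cells of its strip *)

Lemma reshape_index_cons x a k :
  reshape_index (x :: a) k =
  (if (k < x)%N then 0 else (reshape_index a (k - x)).+1)%N.
Proof.
rewrite /reshape_index /= subn_eq0; case: ltnP => // le_xk.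
by rewrite subSn.
Qed.

Lemma leq_reshape_index a k l :
  (k <= l -> reshape_index a k <= reshape_index a l)%N.
Proof.
elim: a k l => [|x a IHa] k l le_kl; first by rewrite /reshape_index.
rewrite !reshape_index_cons; case: ltnP => // le_xk.
by rewrite [(l < x)%N]ltnNge (leq_trans le_xk le_kl) /= ltnS IHa // leq_sub2r.
Qed.

(** Translates block numbers into the partial sums that delimit the rows of [path_strip]. The bound
    on [k] excludes the value [size a], which [reshape_index] takes past the last block. *)
Lemma reshape_index_eq a k r : (k < sumn a)%N ->
  (reshape_index a k == r) = (sumn (take r a) <= k < sumn (take r.+1 a))%N.
Proof.
elim: a k r => [|x a IHa] k [|r] //= lt_k; rewrite reshape_index_cons.
  by rewrite take0 addn0; case: ltnP.
case: ltnP => [lt_kx|le_xk].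
  by rewrite [(_ + _ <= k)%N]leqNgt ltn_addr.
by rewrite eqSS IHa ?leq_subRL ?ltn_subLR // leq_psubRL.
Qed.

Lemma leq_sumn_take a k l : (k <= l)%N ->
  (sumn (take k a) <= sumn (take l a))%N.
Proof.
by move=> le_kl; rewrite -(subnKC le_kl) takeD sumn_cat leq_addr.
Qed.

(** The head is the step that enters the block from the preceding one. The first block is entered
    from nowhere, which is why [path_steps] removes its head. *)
Definition block_steps (k : nat) : seq (Qq * Qq) :=
  (q, 1 - q) :: nseq k.-1 (0, 1).

Definition path_steps (a : seq nat) : seq (Qq * Qq) :=
  behead (flatten [seq block_steps k | k <- a]).

Lemma size_blocks a : all (leq 1) a ->
  size (flatten [seq block_steps k | k <- a]) = sumn a.
Proof.
by elim: a => //= x a IHa /andP[x0 a0];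
  rewrite size_cat size_nseq IHa // -addSn prednK.
Qed.

Lemma nth_blocks a c : all (leq 1) a -> (c < sumn a)%N ->
  nth (0, 0) (flatten [seq block_steps k | k <- a]) c =
  if (0 < c)%N && (reshape_index a c.-1 == reshape_index a c) then (0, 1)
  else (q, 1 - q).
Proof.
elim: a c => //= x a IHa [|c] /andP[x0 a0] lt_c //=.
rewrite nth_cat size_nseq !reshape_index_cons nth_nseq.
have ltp : (c < x.-1)%N = (c.+1 < x)%N by case: x x0 {lt_c}.
rewrite ltp; case: ltnP => [lt_cx|le_xc]; first by rewrite (ltnW lt_cx).
have -> : (c - x.-1 = c.+1 - x)%N by case: x x0 {ltp lt_c} le_xc.
rewrite IHa //; last by rewrite ltn_subLR.
move: le_xc; rewrite leq_eqVlt => /predU1P[->|lt_xc].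
  by rewrite subnn ltnSn.
by rewrite subn_gt0 lt_xc ltnNge -ltnS lt_xc eqSS subSn.
Qed.

(** Column [j] is position [j.-1], and the strip lists the blocks in reverse order: block [r] is the
    row [i] with [i + r.+1 = size a]. *)
Lemma mem_path_cells a i j :
  ((i, j) \in strip_cells (path_strip a)) =
  [&& (0 < j)%N, (j <= sumn a)%N & i + (reshape_index a j.-1).+1 == size a]%N.
Proof.
have sum_take r : (sumn (take r a) <= sumn a)%N.
  by rewrite -{2}(cat_take_drop r a) sumn_cat leq_addr.
rewrite /strip_cells size_mkseq; apply/allpairsPdep/and3P.
  case=> i' [j' [+ + [-> ->]]]; rewrite mem_iota add0n => /andP[_ lt_i].
  rewrite nth_mkseq // mem_iota addSn subnKC;
    last exact/leq_sumn_take/leq_sub2l.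
  rewrite ltnS => /andP[lt_j le_j].
  have j0 : (0 < j')%N := leq_ltn_trans (leq0n _) lt_j.
  have le_ja := leq_trans le_j (sum_take _).
  have /eqP-> : reshape_index a j'.-1 == (size a - i'.+1)%N.
    by rewrite reshape_index_eq ?[(_ - i'.+1).+1]subnSK // prednK // le_j -ltnS
      prednK // lt_j.
  by rewrite subnSK // subnKC // ltnW.
case=> j0 le_j /eqP size_a; exists i, j.
have lt_i : (i < size a)%N by rewrite -size_a -addSnnS leq_addr.
split=> //; first by rewrite mem_iota.
rewrite nth_mkseq // mem_iota addSn subnKC; last exact/leq_sumn_take/leq_sub2l.
have := eqxx (reshape_index a j.-1).
rewrite reshape_index_eq; last by rewrite prednK.
rewrite -ltnS prednK // ltnS; rewrite -size_a addKn addnS subSS addKn.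
by [].
Qed.

Section PathWords.

Variables (a : seq nat) (a_comp : composition a).

Let s := path_strip a.
Let cs : seq (cell s) := sort (relpre (@column s) leq) (enum {: cell s}).

Let cellE (u : cell s) : [&& (0 < column u)%N, (column u <= sumn a)%N &
  rowidx u + (reshape_index a (column u).-1).+1 == size a]%N.
Proof. by rewrite -mem_path_cells /rowidx /column -surjective_pairing (valP u).
  Qed.

Let column_inj : injective (@column s).
Proof.
move=> u v eq_uv; apply/val_inj/eqP;
  rewrite -pair_eqE /= -!/(column _) eq_uv eqxx andbT.
have /and3P[_ _ /eqP ru] := cellE u; have /and3P[_ _ /eqP rv] := cellE v.
by rewrite -(eqn_add2r (reshape_index a (column v).-1).+1) -{1}eq_uv ru rv.
Qed.

Let cs_uniq : uniq cs. Proof. by rewrite sort_uniq enum_uniq. Qed.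
Let mem_cs u : u \in cs. Proof. by rewrite mem_sort mem_enum. Qed.

Let columns : [seq column u | u <- cs] = iota 1 (sumn a).
Proof.
apply: (sorted_eq leq_trans anti_leq).
- by rewrite sorted_map; apply: sort_sorted => ? ?; apply: leq_total.
- exact: iota_sorted.
apply: uniq_perm; rewrite ?iota_uniq ?(map_inj_uniq column_inj) //.
move=> j; rewrite mem_iota add1n ltnS; apply/mapP/andP.
  by case=> u _ ->; have /and3P[] := cellE u.
case=> j0 le_j.
have in_cells : (size a - (reshape_index a j.-1).+1, j)%N \in strip_cells s.
  rewrite mem_path_cells j0 le_j subnK //=.
  by apply: reshape_indexP; rewrite prednK.
by exists (SeqSub in_cells).
Qed.

Let size_cs : size cs = sumn a.
Proof. by rewrite -(size_map (@column s)) columns size_iota. Qed.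

Let rows : sorted geq [seq rowidx u | u <- cs].
Proof.
have -> : [seq rowidx u | u <- cs] =
    [seq size a - (reshape_index a j.-1).+1 | j <- iota 1 (sumn a)]%N.
  rewrite -columns -map_comp; apply: eq_map => u /=.
  by have /and3P[_ _ /eqP<-] := cellE u; rewrite addnK.
apply: (@homo_sorted _ _ _ leq) (iota_sorted _ _) => j k le_jk.
by rewrite /= leq_sub2l // ltnS leq_reshape_index // -!subn1 leq_sub2r.
Qed.

(** The product of [fillings_prod] is compared factor by factor with the steps, since two cells
    share a row exactly when their positions share a block. *)
Lemma LLTpath_words : LLTpath a = word_series (path_steps a).
Proof.
have /andP[a_neq0 a_pos] := a_comp.
have a0 : (0 < sumn a)%N by case: (a) a_neq0 a_pos => //= x b _ /andP[x0 _];
  rewrite ltn_addr.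
have sz_steps : size (path_steps a) = (sumn a).-1
  by rewrite size_behead size_blocks.
have [x0 _] : exists u, u \in cs.
  by case: (cs) size_cs a0 => [<- //|u l _ _]; exists u; apply: mem_head.
apply/boolp.funext => m; rewrite /LLTpath (LLT_words cs_uniq mem_cs (F :=
  word_weight (path_steps a))).
  (* The restriction on the length of [w] can be lifted, as other words have weight 0. *)
  rewrite big_mkcond /=; apply: eq_bigr => w _; rewrite size_cs;
    case: eqP => // /eqP sz_w.
  by rewrite word_weight_size // sz_steps prednK.
move=> T; rewrite (fillings_prod cs_uniq mem_cs _ rows T x0);
  last by rewrite size_cs.
rewrite word_weight_prod; last by rewrite size_map size_cs sz_steps prednK.
rewrite sz_steps size_cs; apply: eq_bigr => c _ /=.
have lt_c : (c.+1 < sumn a)%N by rewrite -[X in (_ < X)%N](prednK a0) ltnS.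
rewrite !(nth_map x0) ?size_cs ?(ltnW lt_c) //.
rewrite nth_behead nth_blocks //=.
have col d : (d < sumn a)%N -> column (nth x0 cs d) = d.+1.
  by move=> lt_d; rewrite -(nth_map _ 0%N) ?size_cs // columns nth_iota.
have /and3P[_ _ /eqP] := cellE (nth x0 cs c.+1).
have /and3P[_ _ /eqP <-] := cellE (nth x0 cs c).
rewrite !col ?(ltnW lt_c) //= => eq_row.
have -> : (rowidx (nth x0 cs c) == rowidx (nth x0 cs c.+1)) =
    (reshape_index a c == reshape_index a c.+1).
  rewrite -eqSS; apply/eqP/eqP => eq_c; apply/eqP.
    by rewrite -eqSS -(eqn_add2l (rowidx (nth x0 cs c))) -eq_row;
      case: eq_c => ->.
  by rewrite eqSS eq_sym -(eqn_add2r (reshape_index a c.+1).+1) eq_row eq_c.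
case: eqP => _ /=; first by rewrite add0r mul1r.
(* At a boundary, [q + (1 - q)] is 1 without a descent, and [q] is left at a descent. *)
by case: (_ <= _)%N; rewrite ?mulr1 ?mulr0 ?addr0 ?subrKC.
Qed.

End PathWords.

(** * Expansions *)

Lemma path_steps_cons x a :
  path_steps (x :: a) = nseq x.-1 (0, 1) ++
    flatten [seq block_steps k | k <- a].
Proof. by []. Qed.

Lemma blocks_path_steps a : a != [::] ->
  flatten [seq block_steps k | k <- a] = (q, 1 - q) :: path_steps a.
Proof. by case: a. Qed.

Lemma path_steps_cat a b : a != [::] -> b != [::] ->
  path_steps (a ++ b) = path_steps a ++ (q, 1 - q) :: path_steps b.
Proof.
case: a => // x a _ b0; rewrite cat_cons !path_steps_cons map_cat flatten_cat
  catA.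
by rewrite (blocks_path_steps b0).
Qed.

Lemma composition_cat a b : composition a -> composition b ->
  composition (a ++ b).
Proof.
by case: a => [//|x a] /andP[_ a0] /andP[_ b0]; apply/andP; rewrite all_cat a0.
Qed.

Lemma composition_near_cat a b :
  composition a -> composition b -> composition (near_cat a b).
Proof.
case: b => [|y b]; first by rewrite /composition.
case: a => // x a /andP[_ a0] /andP[_ /= /andP[y0 b0]].
rewrite /composition /= -size_eq0 size_cat addnS /= all_cat /= b0 andbT.
move: a0; rewrite [_ :: _]lastI all_rcons => /andP[lx ->].
by rewrite addn_gt0 y0 orbT.
Qed.

(** Merging the two blocks at the junction turns the boundary step between them into an inner
    step. *)
Lemma path_steps_near_cat a b : composition a -> composition b ->
  path_steps (near_cat a b) = path_steps a ++ (0, 1) :: path_steps b.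
Proof.
case: b => [|y b]; first by rewrite /composition.
move=> a_comp b_comp; have n_comp := composition_near_cat a_comp b_comp.
suffices blocks : flatten [seq block_steps k | k <- near_cat a (y :: b)] =
    flatten [seq block_steps k | k <- a] ++ (0, 1) :: path_steps (y :: b).
  by rewrite [LHS]/path_steps blocks; case: a {blocks n_comp} a_comp.
case: a a_comp {n_comp} => // x a /andP[_ /= /andP[]].
have /andP[_ /andP[y0 _]] := b_comp.
elim: a x => [|z a IHa] x x0 /=; last first.
  by case/andP=> z0 a0; rewrite IHa // -!cat_cons catA.
(* The inner steps of the merged block number [x + y - 1 = (x - 1) + 1 + (y - 1)], the middle one
   being the junction. *)
case: x y x0 y0 {b_comp} => [//|x] [//|y] _ _ _.
by rewrite cats0 path_steps_cons addSn /= nseqD -catA.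
Qed.

Lemma LLTpath_cat a b : composition a -> composition b ->
  LLTpath (a ++ b) =
    q *: (LLTpath a * LLTpath b) + (1 - q) *: LLTpath (near_cat a b).
Proof.
move=> a_comp b_comp; have /andP[a0 _] := a_comp; have /andP[b0 _] := b_comp.
rewrite !LLTpath_words ?composition_cat ?composition_near_cat //.
rewrite path_steps_cat // path_steps_near_cat // word_series_mul.
exact: word_series_linear.
Qed.

Lemma q_neq0 : q != 0.
Proof. by rewrite tofrac_eq0 polyX_eq0. Qed.

Lemma LLTpath_mul a b : composition a -> composition b ->
  LLTpath a * LLTpath b =
    q^-1 *: LLTpath (a ++ b) + ((q - 1) / q) *: LLTpath (near_cat a b).
Proof.
move=> a_comp b_comp; rewrite LLTpath_cat // scalerDr !scalerA mulVf ?q_neq0 //.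
by rewrite scale1r -addrA -scalerDl (mulrC q^-1) -mulrDl addrA subrK subrr
  mul0r scale0r addr0.
Qed.

Lemma LLTpath1 k : (0 < k)%N -> LLTpath [:: k] = hsym Qq k.
Proof.
case: k => // k _; rewrite LLTpath_words // path_steps_cons cats0.
exact: word_series_inner.
Qed.

Lemma prod_LLTpath a : all (leq 1) a ->
  \prod_(k <- a) LLTpath [:: k] = hsyms Qq a.
Proof.
move=> /allP a0; rewrite /hsyms big_seq [RHS]big_seq.
by apply: eq_bigr => k /a0/LLTpath1.
Qed.

Lemma hsyms_perm (R : comNzRingType) a b : perm_eq a b -> hsyms R a = hsyms R b.
Proof. exact: perm_big. Qed.

(** Adding [x] to the first part commutes with any grouping. Both terms of the recursion in
    [LLTpath_hsyms] are thereby indexed by the coarsenings of [y :: a]. *)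
Lemma coarsenings_near_cat x y a :
  coarsenings ((x + y)%N :: a) =
    [seq near_cat [:: x] b | b <- coarsenings (y :: a)].
Proof.
case: a => [//|z a]; rewrite !coarsenings_cons map_cat -!map_comp.
congr (_ ++ _); apply: eq_map => -[|w b] //=.
by rewrite addnA.
Qed.

Lemma coarsenings_comp a b : composition a -> b \in coarsenings a ->
  composition b /\ (size b <= size a)%N.
Proof.
case: a => // x a /andP[_]; elim: a x b => [|y a IHa] x b.
  by rewrite inE => x0 /eqP->; split; rewrite //= andbT.
case/andP=> x0 /IHa{}IHa; rewrite coarsenings_cons mem_cat.
case/orP=> /mapP[c /IHa[c_comp sz_c] ->{b}].
  split; last by rewrite ltnS.
  by rewrite (composition_cat (a := [:: x])) // /composition /= x0.
split; last by case: c sz_c {c_comp} => //= w c /ltnW.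
by apply: composition_near_cat; rewrite // /composition /= x0.
Qed.

Lemma sum_coarsenings_cons (V : nmodType) (F : seq nat -> V) x y a :
  \sum_(b <- coarsenings [:: x, y & a]) F b =
  \sum_(b <- coarsenings (y :: a)) (F (x :: b) + F (near_cat [:: x] b)).
Proof. by rewrite coarsenings_cons big_cat !big_map [RHS]big_split. Qed.

Lemma size_near_cat1 x b : b != [::] -> size (near_cat [:: x] b) = size b.
Proof. by case: b. Qed.

(** Multiplying the expansion for the tail by the first factor sends each [b] to [x :: b] and
    [near_cat [:: x] b], the two kinds of coarsenings. Only the second loses a part, and it gains
    the factor [q - 1]. *)
Lemma prod_LLTpath_coarsenings a : composition a ->
  \prod_(k <- a) LLTpath [:: k] =
    \sum_(b <- coarsenings a)
      ((q - 1) ^+ (size a - size b) / q ^+ (size a - 1)) *: LLTpath b.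
Proof.
case: a => // x a; elim: a x => [|y a IHa] x a_comp.
  by rewrite !big_seq1 /= divr1 scale1r.
have [x0 ya_comp] : composition [:: x] /\ composition (y :: a).
  by case/and4P: a_comp => _ x0 y0 a0; rewrite /composition /= x0 y0.
rewrite big_cons IHa // sum_coarsenings_cons // mulr_sumr big_seq [RHS]big_seq.
apply: eq_bigr => b /(coarsenings_comp ya_comp)[b_comp sz_b].
have /andP[b0 _] := b_comp.
rewrite -scalerAr LLTpath_mul //= scalerDr !scalerA size_near_cat1 //.
rewrite !subn1 !subSS [(_.+2 - _)%N]subSn //= !exprS.
rewrite invfM; congr (_ *: _ + _ *: _).
  by rewrite -mulrA (mulrC q^-1).
by rewrite mulrACA (mulrC _ (q - 1)) (mulrC q^-1).
Qed.

Lemma LLTpath_hsyms a : composition a ->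
  LLTpath a =
    \sum_(b <- coarsenings a)
      (q ^+ (size b - 1) * (1 - q) ^+ (size a - size b)) *: hsyms Qq b.
Proof.
(* The first part is kept general because the hypothesis is used for both [y :: a] and
   [(x + y) :: a]. *)
case: a => // x a; elim: a x => [|y a IHa] x a_comp.
  have /andP[_ /= /andP[x0 _]] := a_comp.
  by rewrite big_seq1 /= !subnn mulr1 scale1r LLTpath1 // /hsyms big_seq1.
have /and4P[_ x0 y0 a0] := a_comp.
have ya_comp : composition (y :: a) by rewrite /composition /= y0.
have xya_comp : composition ((x + y)%N :: a) by rewrite /composition /=
  addn_gt0 x0.
have -> : LLTpath [:: x, y & a] =
    q *: (LLTpath [:: x] * LLTpath (y :: a)) +
      (1 - q) *: LLTpath ((x + y)%N :: a).
  by rewrite (@LLTpath_cat [:: x] (y :: a)) // /composition /= x0.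
rewrite LLTpath1 // !IHa // coarsenings_near_cat big_map sum_coarsenings_cons.
rewrite mulr_sumr !scaler_sumr -big_split big_seq [RHS]big_seq.
apply: eq_bigr => b /(coarsenings_comp ya_comp)[/andP[b0 _] sz_b].
rewrite size_near_cat1 // -scalerAr !scalerA /hsyms [in RHS]big_cons.
case: b b0 sz_b => // z b _ sz_b; congr (_ *: _ + _ *: _).
  by rewrite /= !subn1 /= subSS exprS mulrA.
by rewrite (subSn sz_b) exprS mulrCA.
Qed.

Lemma sum_coarsenings_Mset (V : nmodType) (F : seq nat -> V) a :
  \sum_(l <- Mset a) F l = \sum_(b <- coarsenings a) F (lam b).
Proof. by rewrite (perm_big _ (perm_eq_seq_mset _)) big_map. Qed.

(** * Linear independence of the products of complete symmetric functions *)

Section Independence.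

Variable R : comNzRingType.
Implicit Types (f g : series R) (m : monom) (i j k : nat) (b l : seq nat).

Lemma size_msetD (A B : monom) : size (A `+` B)%mset = (size A + size B)%N.
Proof. by rewrite -(perm_size (perm_msetD A B)) size_cat. Qed.

Lemma size_msetn j i : size (msetn j i : monom) = j.
Proof.
rewrite -[RHS](size_nseq j i); apply: perm_size; apply/allP => x _ /=.
by rewrite count_mem_mset msetnE count_nseq /=; case: (eqVneq x i) => _;
  rewrite ?mul1n.
Qed.

Definition var_pow i j : series R := fun m => (m == msetn j i)%:R.

Lemma var_pow_mul i j f m :
  (var_pow i j * f) m = if (j <= m i)%N then f (m `\` msetn j i)%mset else 0.
Proof.
have -> : (j <= m i)%N = (msetn j i \in submsets m).
  rewrite mem_submsets; apply/idP/msubsetP => [le_j x|/(_ i)].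
    by rewrite msetnE; case: eqP => // ->.
  by rewrite msetnxx.
rewrite [LHS](_ : _ = \sum_(d <- submsets m) var_pow i j d * f (m `\` d)%mset)
  //.
case: ifP => [in_m|notin_m].
  rewrite (bigD1_seq _ in_m) ?submsets_uniq //= /var_pow eqxx mul1r.
  by rewrite big1 ?addr0 // => d /negPf->; rewrite mul0r.
rewrite big_seq big1 // => d d_m; rewrite /var_pow; case: eqP d_m => [->|_ _].
  by rewrite notin_m.
by rewrite mul0r.
Qed.

(* The Euler operator x_i d/dx_i *)
Definition euler i f : series R := fun m => (m i)%:R * f m.

(** The exponent of [x_i] is additive over each splitting of a monomial. *)
Lemma euler_mul i f g : euler i (f * g) = euler i f * g + f * euler i g.
Proof.
apply/boolp.funext => m.
rewrite [LHS](_ : _ = (m i)%:R * \sum_(d <- submsets m) f d * g (m `\` d)%mset)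
  //.
rewrite [RHS](_ : _ = \sum_(d <- submsets m) euler i f d * g (m `\` d)%mset
    + \sum_(d <- submsets m) f d * euler i g (m `\` d)%mset) //.
rewrite -big_split mulr_sumr big_seq [RHS]big_seq; apply: eq_bigr => d.
rewrite mem_submsets => /msetBDKC {1}<-; rewrite /euler msetE2 natrD.
by rewrite mulrDl mulrA; congr (_ + _); rewrite mulrCA.
Qed.

Lemma euler_linear i c f g : euler i (c *: f + g) = c *: euler i f + euler i g.
Proof.
by apply/boolp.funext => m; rewrite [LHS]mulrDr [X in X + _]mulrCA.
Qed.

HB.instance Definition _ i :=
  GRing.isLinear.Build R (series R) (series R) *:%R (euler i) (euler_linear i).

Lemma series_sumE I r (P : pred I) (F : I -> series R) m :
  (\sum_(x <- r | P x) F x) m = \sum_(x <- r | P x) F x m.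
Proof. by elim/big_rec2: _ => // x y1 y2 _ <-. Qed.

(** The factor [m i] counts the [j >= 1] such that [x_i ^ j] divides [m]. The common bound [M]
    allows sums over [n] and [j] to be exchanged later. *)
Lemma euler_hsym i n M : (n <= M)%N ->
  euler i (hsym R n) =
    \sum_(1 <= j < M.+1 | (j <= n)%N) var_pow i j * hsym R (n - j).
Proof.
move=> le_nM; apply/boolp.funext => m; rewrite series_sumE.
have sz j : (j <= m i)%N -> (size m = j + size (m `\` msetn j i)%mset)%N.
  move=> le_j; rewrite -[X in (X + _)%N](size_msetn j i) -size_msetD msetBDKC
    //.
  by apply/msubsetP => x; rewrite msetnE; case: eqP => // ->.
have le_mi : (m i <= size m)%N by rewrite (sz (m i)) ?leq_addr.
transitivity (\sum_(1 <= j < M.+1 | (j <= n)%N)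
  ((j <= m i) && (size m == n))%N%:R : R).
  rewrite /euler /hsym; case: (size m =P n) => [sz_m|_]; last first.
    by rewrite mulr0 big1 // => j _; rewrite andbF.
  rewrite mulr1 -natr_sum; congr (_%:R).
  have {1}-> : m i = (\sum_(1 <= j < (m i).+1) 1)%N by rewrite
    sum_nat_const_nat subn1 muln1.
  rewrite (big_nat_widen _ _ M.+1);
    last by rewrite ltnS (leq_trans le_mi) ?sz_m.
  rewrite big_mkcond [RHS]big_mkcond; apply: eq_bigr => j _;
    rewrite andbT ltnS /=.
  case: (leqP j (m i)) => [le_j|_]; last by case: ifP.
  by rewrite -sz_m (leq_trans le_j).
apply: eq_bigr => j le_jn; rewrite var_pow_mul.
case: (leqP j (m i)) => //= le_j; rewrite (sz _ le_j) /hsym.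
by rewrite -{1}(subnKC le_jn) eqn_add2l.
Qed.

Lemma hsym0 : hsym R 0 = 1.
Proof. by apply/boolp.funext => m; rewrite /hsym size_mset_eq0. Qed.

(** Chain rule: the factor before [euler i (hsym R n)] is the partial derivative with respect to
    [hsym n]. *)
Lemma euler_hsyms i l M : all (fun k => 0 < k <= M)%N l ->
  euler i (hsyms R l) = \sum_(1 <= n < M.+1)
    (count_mem n l)%:R *: (hsyms R (rem n l) * euler i (hsym R n)).
Proof.
elim: l => [|x l IHl] /=.
  rewrite /hsyms big_nil big1 => [_|n _]; last by rewrite scale0r.
  apply/boolp.funext => m; rewrite /euler.
  rewrite [X in _ * X](_ : _ = (m == mset0)%:R) //.
  by case: eqP => [->|_]; rewrite ?mset0E ?mul0r ?mulr0.
case/andP=> /andP[x0 le_xM] /IHl{}IHl; rewrite /hsyms big_cons -/(hsyms R l).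
rewrite euler_mul IHl mulr_sumr.
under [RHS]eq_bigr do rewrite natrD scalerDl.
rewrite big_split; congr (_ + _).
  rewrite (bigD1_seq x) ?iota_uniq ?mem_index_iota ?x0 //= eqxx scale1r mulrC.
  by rewrite [X in _ + X]big1 ?addr0 // => n /negPf; rewrite eq_sym => ->;
    rewrite scale0r.
apply: eq_bigr => n _; rewrite -scalerAr mulrA.
have [/perm_to_rem n_l|/count_memPn->] := boolP (n \in l);
  last by rewrite !scale0r.
(* If [x = n], [rem] deletes the head and leaves [l], a rearrangement of [n :: rem n l]. *)
congr (_ *: (_ * _)); case: (x =P n) => [->|_]; last by rewrite /hsyms big_cons.
by rewrite /hsyms (perm_big _ n_l) big_cons.
Qed.

Lemma fresh_variable m : exists i, m i = 0%N.
Proof.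
exists (\max_(x <- m) x).+1; apply/mset_eq0P;
  apply/negP => /(@leq_bigmax_seq _ _ xpredT id).
by move=> /(_ isT); rewrite ltnn.
Qed.

(* Comparing the coefficients of m * x_i^j, where x_i does not occur in m, makes
   the system triangular. *)
Lemma var_pow_independent M (A : nat -> series R) :
    (forall i, \sum_(1 <= j < M.+1) var_pow i j * A j = 0) ->
  forall j, (0 < j <= M)%N -> A j = 0.
Proof.
move=> sumA0; elim/ltn_ind => j IHj /andP[j0 le_jM].
apply/boolp.funext => m; have [i m_i] := fresh_variable m.
(* The coefficient of [m * x_i ^ j] in term [k]: it is 0 for [k > j], and by induction for
   [k < j]. *)
pose B k := if (k <= j)%N then A k ((m `+` msetn j i) `\` msetn k i)%mset else
  0.
have : \sum_(1 <= k < M.+1) B k = 0.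
  transitivity ((\sum_(1 <= k < M.+1) var_pow i k * A k)
    (m `+` msetn j i)%mset).
    rewrite series_sumE; apply: eq_bigr => k _.
    by rewrite (var_pow_mul i k (A k)) msetE2 msetnxx m_i.
  by rewrite sumA0.
rewrite (bigD1_seq j) ?iota_uniq ?mem_index_iota ?j0 //=.
rewrite {1}/B leqnn msetDKBC big_seq_cond big1 ?addr0 // => k.
case/andP; rewrite mem_index_iota => /andP[k0 _] ne_kj; rewrite /B;
  case: ifP => // le_kj.
by rewrite IHj ?k0 ?ltn_neqAle ?ne_kj //= (leq_trans le_kj).
Qed.

(** Sorted by powers of [x_i], the relation has coefficients [A j], which all vanish. Since
    [hsym 0 = 1], [A n] is [F n] plus multiples of the [F k] with [k > n], so descending induction
    from [M] applies. *)
Lemma euler_independent M (F : nat -> series R) :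
    (forall i, \sum_(1 <= n < M.+1) F n * euler i (hsym R n) = 0) ->
  forall n, (0 < n <= M)%N -> F n = 0.
Proof.
move=> sumF0; pose A j := \sum_(1 <= n < M.+1 | (j <= n)%N)
  F n * hsym R (n - j).
have sumA0 i : \sum_(1 <= j < M.+1) var_pow i j * A j = 0.
  rewrite -[RHS](sumF0 i) (eq_bigr (fun j => \sum_(1 <= n < M.+1 | (j <= n)%N)
    F n * (var_pow i j * hsym R (n - j)))); last first.
    by move=> j _; rewrite mulr_sumr; apply: eq_bigr => n _; rewrite mulrCA.
  rewrite (exchange_big_dep xpredT) //= big_nat [RHS]big_nat.
  by apply: eq_bigr => n /andP[_ le_nM]; rewrite -mulr_sumr -euler_hsym.
have A0 := var_pow_independent sumA0.
move=> n; have [d] := ubnP (M - n);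
  elim: d n => // d IHd n lt_d /andP[n0 le_nM].
have : A n = 0 by rewrite A0 ?n0.
rewrite /A big_mkcond (bigD1_seq n) ?iota_uniq ?mem_index_iota ?n0 //=.
rewrite leqnn subnn hsym0 mulr1 big_seq_cond big1 ?addr0 // => k.
rewrite mem_index_iota ltnS => /andP[/andP[k0 le_kM] ne_kn].
case: ifP => // le_nk; have lt_nk : (n < k)%N
  by rewrite ltn_neqAle eq_sym ne_kn.
rewrite IHd ?mul0r ?k0 //; apply: leq_trans (ltnSE lt_d).
by rewrite ltn_sub2l // (leq_trans lt_nk).
Qed.

End Independence.

Lemma hsyms_mset0 (R : comNzRingType) b : all (leq 1) b ->
  (hsyms R b) mset0 = (b == [::])%:R.
Proof.
case: b => [_|x b /andP[x0 _]];
  first by rewrite /hsyms big_nil -hsym0 /hsym size_mset0.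
rewrite /hsyms big_cons /=.
rewrite [LHS](_ : _ = \sum_(d <- submsets mset0)
    hsym R x d * hsyms R b (mset0 `\` d)%mset) //.
rewrite big_seq big1 // => d; rewrite mem_submsets msubset0 => /eqP->.
by rewrite /hsym size_mset0; case: x x0 => // x _; rewrite mul0r.
Qed.

(** [L] may repeat an index in several orders, hence the sum over rearrangements of [l]. In the
    derivative with respect to [hsym n], the coefficient at [l] is the one at [n :: l] times the
    multiplicity of [n] in [n :: l], invertible in characteristic 0. *)
Lemma hsyms_independent (R : fieldType) (L : seq (R * seq nat)) :
    [pchar R] =i pred0 -> all (fun p => all (leq 1) p.2) L ->
    \sum_(p <- L) p.1 *: hsyms R p.2 = 0 ->
  forall l, \sum_(p <- L | perm_eq p.2 l) p.1 = 0.
Proof.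
move=> char0 L_pos sumL0 l; elim: l L L_pos sumL0 => [|n l IHl] L L_pos sumL0.
  have : (\sum_(p <- L) p.1 *: hsyms R p.2) mset0 = 0 by rewrite sumL0.
  rewrite series_sumE => coef0; rewrite -[RHS]coef0 [LHS]big_mkcond
    [LHS]big_seq [RHS]big_seq.
  apply: eq_bigr => p /(allP L_pos) p_pos.
  rewrite [RHS](_ : _ = p.1 * hsyms R p.2 mset0) // hsyms_mset0 //.
  have -> : perm_eq p.2 [::] = (p.2 == [::]).
    by apply/idP/eqP => [/perm_nilP|->].
  by case: eqP; rewrite ?mulr1 ?mulr0.
have [->|n0] := posnP n.
  rewrite big_seq_cond big1 // => p /andP[/(allP L_pos) p_pos /perm_mem p_l].
  by move/allP: p_pos => /(_ 0%N); rewrite p_l mem_head => /(_ isT).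
pose M := (n + \sum_(p <- L) sumn p.2)%N.
have L_le p : p \in L -> all (fun k => 0 < k <= M)%N p.2.
  move=> p_L; apply/allP => k k_p; rewrite (allP (allP L_pos p p_L)) //=.
  apply: leq_trans (leq_addl _ _).
  rewrite (big_rem p) //= (leq_trans _ (leq_addr _ _)) //.
  by rewrite sumnE (big_rem k) //= leq_addr.
pose F k := \sum_(p <- L) (p.1 * (count_mem k p.2)%:R) *: hsyms R (rem k p.2).
have F0 : F n = 0.
  apply: (@euler_independent R M F) => [i|]; last by rewrite n0 leq_addr.
  transitivity (euler i (\sum_(p <- L) p.1 *: hsyms R p.2)); last first.
    by rewrite sumL0 linear0.
  rewrite linear_sum (eq_bigr (fun k => \sum_(p <- L) p.1 *:
    ((count_mem k p.2)%:R *: (hsyms R (rem k p.2) * euler i (hsym R k))))).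
    rewrite exchange_big big_seq [RHS]big_seq; apply: eq_bigr => p p_L.
    by rewrite linearZ /= (euler_hsyms _ i (L_le p p_L)) scaler_sumr.
  by move=> k _; rewrite mulr_suml; apply: eq_bigr => p _;
    rewrite -scalerAl scalerA.
(* Entries without [n] contribute 0; once they are dropped, [p.2] is always a rearrangement of
   [n :: rem n p.2]. *)
pose L' := [seq (p.1 * (count_mem n p.2)%:R, rem n p.2) | p <- L & n \in p.2].
have : \sum_(p <- L' | perm_eq p.2 l) p.1 = 0.
  apply: IHl.
    apply/allP => _ /mapP[p + ->] /=;
      rewrite mem_filter => /andP[_ /(allP L_pos)/allP p_pos].
    by apply/allP => k /mem_rem/p_pos.
  rewrite big_map big_filter -[RHS]F0 big_mkcond; apply: eq_bigr => p _ /=.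
  by case: ifP => // /negbT/count_memPn->; rewrite mulr0 scale0r.
rewrite big_map big_filter_cond /=.
rewrite (eq_big (fun p => perm_eq p.2 (n :: l)) (fun p =>
  p.1 * (count_mem n l).+1%:R)).
- rewrite -mulr_suml => /eqP; rewrite mulf_eq0; have /pcharf0P -> := char0.
  by rewrite orbF => /eqP.
- move=> p; apply/andP/idP => [[n_p p_l]|p_l].
    by rewrite (permPl (perm_to_rem n_p)) perm_cons.
  have n_p : n \in p.2 by rewrite (perm_mem p_l) mem_head.
  by rewrite n_p; split; rewrite // -(perm_cons n) -(permPl (perm_to_rem n_p)).
move=> p /andP[n_p /permP p_l].
by have /permP -> := perm_to_rem n_p; rewrite /= eqxx p_l.
Qed.

(** * The criterion for equality of two path LLT polynomials *)

Lemma Qq_char0 : [pchar Qq] =i pred0.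
Proof.
apply/pcharf0P => n.
have -> : n%:R = tofrac (n%:R : {poly rat}) by rewrite rmorph_nat.
by rewrite tofrac_eq0 -polyC_natr polyC_eq0 Num.Theory.pnatr_eq0.
Qed.

Lemma subr1q_neq0 : 1 - q != 0.
Proof.
rewrite /q -tofrac1 -tofracB tofrac_eq0 subr_eq0 eq_sym.
by apply/eqP => /(congr1 (size \o polyseq)) /=; rewrite size_polyX size_poly1.
Qed.

(** The exponent is the degree of the underlying polynomial. *)
Lemma exp_subr1q_inj : injective (fun n => (1 - q) ^+ n).
Proof.
move=> i j /eqP; rewrite -tofrac1 -tofracB -!tofracXn tofrac_eq.
move=> /eqP/(congr1 (fun p : {poly rat} => (size p).-1)).
have sz : size (1 - 'X : {poly rat}) = 2%N
  by rewrite -opprB size_polyN size_XsubC.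
by rewrite !size_exp sz !mul1n.
Qed.

Lemma natr_inj_Qq m n : m%:R = n%:R :> Qq -> m = n.
Proof.
have le_inj k l : k%:R = l%:R :> Qq -> (l <= k)%N.
  move=> eq_kl; rewrite leqNgt; apply/negP => lt_kl.
  have /pcharf0P/(_ (l - k)%N) := Qq_char0.
  by rewrite natrB 1?ltnW // eq_kl subrr eqxx subn_eq0 leqNgt lt_kl.
by move=> eq_mn; apply/eqP; rewrite eqn_leq !le_inj.
Qed.

Definition coarsening_count a l := count (fun b => perm_eq b l) (coarsenings a).

Lemma coarsening_count1 a k : composition a ->
  coarsening_count a [:: k] = ([:: k] \in coarsenings a).
Proof.
move=> a_comp; rewrite -(count_uniq_mem _ (coarsenings_uniq a_comp)).
by apply: eq_count => b; apply/idP/eqP => [/perm_small_eq-> | ->].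
Qed.

Lemma sumn_coarsening a : a != [::] -> [:: sumn a] \in coarsenings a.
Proof. by move=> a0; apply/coarseningsP; exists [:: a];
  rewrite /= a0 cats0. Qed.

Lemma self_coarsening a : a \in coarsenings a.
Proof.
apply/coarseningsP; exists [seq [:: k] | k <- a]; split.
- by rewrite all_map; apply/allP.
- by elim: a => //= x a ->.
by elim: a => //= x a <-; rewrite addn0.
Qed.

(** Compares the coefficients at [l] in the two expansions; the power of [q] depends on [l] alone
    and cancels. *)
Lemma LLTpath_eq_count a b l : composition a -> composition b ->
  LLTpath a = LLTpath b ->
  (coarsening_count a l)%:R * (1 - q) ^+ (size a - size l) =
  (coarsening_count b l)%:R * (1 - q) ^+ (size b - size l).
Proof.
move=> a_comp b_comp eq_ab.
pose c (d e : seq nat) := q ^+ (size e - 1) * (1 - q) ^+ (size d - size e).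
have pos d e : composition d -> e \in coarsenings d -> all (leq 1) e.
  by move=> d_comp /(coarsenings_comp d_comp)[/andP[]].
have count_sum d : \sum_(e <- coarsenings d | perm_eq e l) c d e =
    q ^+ (size l - 1) * ((coarsening_count d l)%:R *
      (1 - q) ^+ (size d - size l)).
  rewrite (eq_bigr (fun=> c d l)) => [|e /perm_size sz_e];
    last by rewrite /c sz_e.
  by rewrite big_const_seq iter_addr_0 /c -[LHS]mulr_natl mulrCA.
have := @hsyms_independent _ ([seq (c a e, e) | e <- coarsenings a] ++
  [seq (- c b e, e) | e <- coarsenings b]) Qq_char0 _ _ l.
rewrite !big_cat !big_map /= sumrN !count_sum -mulrBr => sum0.
apply/eqP; rewrite -subr_eq0.
have /eqP : q ^+ (size l - 1) * ((coarsening_count a l)%:R * (1 - q) ^+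
  (size a - size l)
    - (coarsening_count b l)%:R * (1 - q) ^+ (size b - size l)) = 0.
  apply: sum0.
    by rewrite all_cat !all_map; apply/andP; split; apply/allP => e; apply: pos.
  under [X in _ + X]eq_bigr do rewrite scaleNr.
  by rewrite sumrN -!LLTpath_hsyms // eq_ab subrr.
by rewrite mulf_eq0 expf_eq0 (negPf q_neq0) andbF.
Qed.

(** At [[:: sumn a]] the coefficient for [a] is a nonzero power of [1 - q]. That of [b] must then be
    nonzero too, and the exponents agree. *)
Lemma LLTpath_eq_size a b : composition a -> composition b ->
  LLTpath a = LLTpath b -> size a = size b.
Proof.
move=> a_comp b_comp /(LLTpath_eq_count [:: sumn a] a_comp b_comp).
have [/andP[a0 _] /andP[b0 _]] := (a_comp, b_comp).
rewrite !coarsening_count1 // sumn_coarsening //; case: (_ \in _) => /=.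
  by rewrite !mul1r => /exp_subr1q_inj;
    case: (a) (b) a0 b0 => [|? ?] [|? ?] //= _ _; rewrite !subn1 => /= ->.
by rewrite mul1r mul0r => /eqP; rewrite expf_eq0 (negPf subr1q_neq0) andbF.
Qed.

Lemma lam_eq a b : (lam a == lam b) = perm_eq a b.
Proof.
apply/eqP/idP => [eq_ab|].
  by rewrite -(perm_sort geq a) -/(lam a) eq_ab perm_sort.
move/perm_sortP; apply.
- by move=> x y; apply: leq_total.
- by move=> x y z le_xy /leq_trans; apply.
- by move=> x y; rewrite andbC => /anti_leq.
Qed.

Lemma Mset_count a l : Mset a (lam l) = coarsening_count a l.
Proof. by rewrite mset_seqE count_map; apply: eq_count => b;
  rewrite /= lam_eq. Qed.

(** A composition is its own longest coarsening, so the largest length occurring in [Mset a] is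
    [size a]. *)
Lemma Mset_eq_size a b : composition a -> composition b ->
  Mset a = Mset b -> size a = size b.
Proof.
have le_size c d : composition d -> Mset c = Mset d -> (size c <= size d)%N.
  move=> d_comp eq_cd; have : (0 < coarsening_count d c)%N.
    by rewrite -Mset_count -eq_cd Mset_count -has_count; apply/hasP; exists c;
      rewrite ?self_coarsening.
  rewrite -has_count => /hasP[e /(coarsenings_comp d_comp)[_ le_ed] /perm_size
    <-].
  exact: le_ed.
by move=> a_comp b_comp eq_ab; apply/eqP; rewrite eqn_leq !le_size.
Qed.

Lemma LLTpath_Mset a : composition a ->
  LLTpath a = \sum_(l <- Mset a)
    (q ^+ (size l - 1) * (1 - q) ^+ (size a - size l)) *: hsyms Qq l.
Proof.
move=> a_comp; rewrite sum_coarsenings_Mset LLTpath_hsyms //.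
by apply: eq_bigr => b _; rewrite size_sort (@hsyms_perm _ (lam b) b) //
  perm_sort.
Qed.

Lemma LLTpath_eqP a b : composition a -> composition b ->
  LLTpath a = LLTpath b <-> Mset a = Mset b.
Proof.
move=> a_comp b_comp; split=> eq_ab; last first.
  by rewrite !LLTpath_Mset // eq_ab (Mset_eq_size a_comp b_comp eq_ab).
have eq_size := LLTpath_eq_size a_comp b_comp eq_ab.
(* Unsorted sequences have multiplicity 0 in both multisets. *)
apply/msetP => l; have [l_sort|l_nsort] := eqVneq (lam l) l; last first.
  suffices no_l d : Mset d l = 0%N by rewrite !no_l.
  rewrite mset_seqE; apply/count_memPn/mapP => -[e _ l_def].
  case/eqP: l_nsort; rewrite l_def; apply/eqP; rewrite lam_eq.
  by rewrite perm_sort.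
rewrite -l_sort !Mset_count; apply/natr_inj_Qq.
apply: (mulIf (x := (1 - q) ^+ (size a - size l))).
  by rewrite expf_neq0 // subr1q_neq0.
by rewrite {2}eq_size; apply: LLTpath_eq_count.
Qed.

(* In the expansion of [LLTpath a] the base of the second power is [1 - q]:
   with [q - 1] it would contradict the first identity, already for
   [a = b = [:: 1]], where that identity gives
   [LLTpath [:: 1; 1] = q *: hsym 1 ^+ 2 + (1 - q) *: hsym 2]. *)
Theorem theorem4p12 :
  [/\ forall a b : seq nat, composition a -> composition b ->
        LLTpath a * LLTpath b =
          q^-1 *: LLTpath (a ++ b) + ((q - 1) / q) *: LLTpath (near_cat a b),
      forall a : seq nat, composition a ->
        hsyms Qq (lam a) = \prod_(k <- a) LLTpath [:: k]
        /\ \prod_(k <- a) LLTpath [:: k] =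
             \sum_(b <- coarsenings a)
               ((q - 1) ^+ (size a - size b) / q ^+ (size a - 1)) *: LLTpath b,
      forall a : seq nat, composition a ->
        LLTpath a =
          \sum_(b <- coarsenings a)
            (q ^+ (size b - 1) * (1 - q) ^+ (size a - size b)) *: hsyms Qq (lam b)
        /\ \sum_(b <- coarsenings a)
             (q ^+ (size b - 1) * (1 - q) ^+ (size a - size b)) *: hsyms Qq (lam b) =
           \sum_(l <- Mset a)
             (q ^+ (size l - 1) * (1 - q) ^+ (size a - size l)) *: hsyms Qq l
    & forall a b : seq nat, composition a -> composition b ->
        LLTpath a = LLTpath b <-> Mset a = Mset b].
Proof.
have lamE b : hsyms Qq (lam b) = hsyms Qq b by apply: hsyms_perm; rewrite perm_sort.
split=> [|a a_comp|a a_comp|]; last exact: LLTpath_eqP.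
- exact: LLTpath_mul.
- split; last exact: prod_LLTpath_coarsenings.
  by rewrite lamE prod_LLTpath //; case/andP: a_comp.
split; first by under eq_bigr do rewrite lamE; apply: LLTpath_hsyms.
by rewrite sum_coarsenings_Mset; apply: eq_bigr => b _; rewrite size_sort.
Qed.
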